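(* If $F \subseteq \mathbb{R}^2$ is any set with $\dim_{\mathrm{A}} F > 1$, then $\dim_{\mathrm{A}} D(F) = 1$.
   Context: For a set $F \subseteq \mathbb{R}^d$, the distance set is $D(F) = \{ |x-y| : x,y \in F\} \subseteq \mathbb{R}$, where $|\cdot|$ is the Euclidean norm. For a non-empty bounded set $E \subset \mathbb{R}^d$ and $r>0$, $N_r(E)$ is the smallest number of open sets of diameter at most $r$ required to cover $E$. The Assouad dimension of a non-empty set $F \subseteq \mathbb{R}^d$ is $$\dim_{\mathrm{A}} F = \inf\Big\{ s \geq 0 : (\exists C>0)(\forall R>0)(\forall r \in (0,R))(\forall x \in F)\ N_r(B(x,R)\cap F) \leq C (R/r)^s \Big\},$$ where $B(x,R)$ is the closed ball with centre $x$ and radius $R$. *)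

(* Defs.v *)
From mathcomp Require Import all_boot all_order all_algebra.
From mathcomp Require Import all_classical all_reals all_analysis.

Set Implicit Arguments.
Unset Strict Implicit.
Unset Printing Implicit Defensive.

Import Order.TTheory GRing.Theory Num.Theory.
Import numFieldNormedType.Exports.

Local Open Scope classical_set_scope.
Local Open Scope ring_scope.

(* The library norm on 'rV[R]_d is the sup norm, so the Euclidean distance has
   to be defined here.  The two induce the same topology: the library's
   [open] is therefore used for open subsets of R^d. *)
Definition edist (R : realType) (d : nat) (x y : 'rV[R]_d) : R :=
  Num.sqrt (\sum_(i < d) (x 0 i - y 0 i) ^+ 2).

Definition eclosed_ball (R : realType) (d : nat) (x : 'rV[R]_d) (rho : R) :
  set 'rV[R]_d := [set y | edist x y <= rho].

(* [diameter set0 = -oo], so that the empty set has diameter at most r. *)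
Definition diameter (R : realType) (d : nat) (A : set 'rV[R]_d) : \bar R :=
  ereal_sup [set (edist p.1 p.2)%:E | p in A `*` A].

Definition open_cover_of_size (R : realType) (d : nat) (r : R)
    (E : set 'rV[R]_d) (n : nat) : Prop :=
  exists U : 'I_n -> set 'rV[R]_d,
    (forall i, open (U i) /\ (diameter (U i) <= r%:E)%E) /\
    E `<=` \bigcup_i U i.

(* Equal to +oo when there is no finite cover, which does not occur for
   bounded E and r > 0. *)
Definition covering_number (R : realType) (d : nat) (r : R)
    (E : set 'rV[R]_d) : \bar R :=
  ereal_inf [set n%:R%:E | n in open_cover_of_size r E].

Definition assouad_dim (R : realType) (d : nat) (F : set 'rV[R]_d) : \bar R :=
  ereal_inf [set s%:E | s in [set s : R | 0 <= s /\
    exists C : R, 0 < C /\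
      forall rho : R, 0 < rho ->
      forall r : R, 0 < r -> r < rho ->
      forall x : 'rV[R]_d, F x ->
        (covering_number r (eclosed_ball x rho `&` F)
           <= (C * (rho / r) `^ s)%:E)%E]].

Definition distance_set (R : realType) (d : nat) (F : set 'rV[R]_d) : set R :=
  [set t | exists x y, [/\ F x, F y & t = edist x y]].

(* A subset of R seen as a subset of R^1 (where [edist] is `|s - t|). *)
Definition real_line (R : realType) (A : set R) : set 'rV[R]_1 :=
  [set const_mx t | t in A].

(* Main.v *)
Require Import Defs.
From mathcomp Require Import all_boot all_order all_algebra.
From mathcomp Require Import all_classical all_reals all_analysis.
From mathcomp Require Import zify ring lra.
(* mathcomp-analysis also has an [edist]. *)
Import Defs.

Set Implicit Arguments.
Unset Strict Implicit.
Unset Printing Implicit Defensive.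

Import Order.TTheory GRing.Theory Num.Theory.
Import numFieldNormedType.Exports.

Local Open Scope classical_set_scope.
Local Open Scope ring_scope.

(** Fix 1 < s < dim_A F.  At suitable scales, F contains finite sets with
    arbitrarily many more than (L / h)^s points from distinct h-cells of a square
    of side L; call these dense.  Choosing the square almost optimally makes the
    counting measure s-Frostman above scale h.  Since s > 1, Marstrand's energy
    argument over the m directions (1, k/m) then gives a k for which the
    projection of the square meets a fixed proportion of the m intervals of
    length L/m.

    Such a pair (square, k) yields many distances as soon as F has a pin, far
    from the points, lying in direction (1, k/m) from them: distances to the pin
    then behave like the projection.  Now let a dense set P and a k be given.
    Some tube in direction (1, k/m) contains two far apart cells of large mass,
    because the Frostman exponent exceeds 1; a point of one cell is a pin for all
    points of the other, which again form a dense set.  If D(F) had Assouad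
    dimension less than 1, that cell could contain no square with a large k-th
    projection.  Hence dense sets can be refined successively so as to exclude
    k = 0, ..., m - 1, and the last one contradicts Marstrand. *)

(** * Counting in fibers and cells *)

Definition int_segment (a : int) (d : nat) : seq int :=
  [seq a - d%:Z + i%:Z | i : nat <- iota 0 (2 * d + 1)].

Lemma size_int_segment a d : size (int_segment a d) = (2 * d + 1)%N.
Proof. by rewrite size_map size_iota. Qed.

Lemma int_segment_uniq a d : uniq (int_segment a d).
Proof. by rewrite map_inj_uniq ?iota_uniq // => i j /addrI[]. Qed.

Lemma mem_int_segment a d (i : int) : `|i - a| <= d%:Z -> i \in int_segment a d.
Proof.
move=> hi; apply/mapP; exists (absz (i - a + d%:Z)); last by lia.
by rewrite mem_iota; lia.
Qed.

Lemma size_le_int_segment (a : int) (d : nat) (s : seq int) :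
  uniq s -> (forall i, i \in s -> `|i - a| <= d%:Z) -> (size s <= 2 * d + 1)%N.
Proof.
move=> us hs; rewrite -(size_int_segment a).
by apply: uniq_leq_size => // i /hs; exact: mem_int_segment.
Qed.

Lemma size_le_int_box (a b : int) (d : nat) (s : seq (int * int)) : uniq s ->
  (forall c, c \in s -> `|c.1 - a| <= d%:Z /\ `|c.2 - b| <= d%:Z) ->
  (size s <= (2 * d + 1) ^ 2)%N.
Proof.
move=> us hs.
have -> : ((2 * d + 1) ^ 2 =
    size [seq (i, j) | i <- int_segment a d, j <- int_segment b d])%N.
  by rewrite size_allpairs !size_int_segment.
apply: uniq_leq_size => // -[i j] /hs /= [hi hj].
by apply/allpairsP; exists (i, j) => /=; split => //; exact: mem_int_segment.
Qed.

Section floor_distance.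
Variable R : realType.
Implicit Types x y : R.

Lemma dist_floor_le x y (d : nat) :
  `|x - y| <= d%:R -> `|Num.floor x - Num.floor y| <= d%:Z + 1.
Proof.
move=> hd.
have hx := floor_le x; have hx' := floorD1_gt x.
have hy := floor_le y; have hy' := floorD1_gt y.
rewrite -ltzD1 -(ltr_int R); move: hx' hy' hd.
rewrite intr_norm !rmorphD rmorphN /= => hx' hy'.
rewrite ler_norml => /andP[h1 h2]; rewrite ltr_norml; lra.
Qed.

Lemma floor_near x y (d : nat) :
  `|Num.floor x - Num.floor y| <= d%:Z -> `|x - y| <= d%:R + 1.
Proof.
move=> e.
have hx := floor_le x; have hx' := floorD1_gt x.
have hy := floor_le y; have hy' := floorD1_gt y.
move: e hx' hy'; rewrite -(ler_int R) intr_norm !rmorphD rmorphN /=.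
rewrite ler_norml => /andP[e1 e2] hx' hy'; rewrite ler_norml; lra.
Qed.

Lemma floor_eq_dist x y : Num.floor x = Num.floor y -> `|x - y| < 1.
Proof.
move=> e.
have hx := floor_le x; have hx' := floorD1_gt x.
have hy := floor_le y; have hy' := floorD1_gt y.
move: hx hx' hy hy'; rewrite e !rmorphD /= => *; rewrite ltr_norml; lra.
Qed.

Lemma floor_gap x y (d : nat) :
  Num.floor y + d%:Z + 1 <= Num.floor x -> d%:R <= x - y.
Proof.
move=> e.
have hx := floor_le x; have hy := floorD1_gt y.
move: e hy; rewrite -(ler_int R) !rmorphD /= => e hy; lra.
Qed.

End floor_distance.

Section fibers.
Variables (T I : eqType) (f : T -> I).
Implicit Types (P : seq T) (cs : seq I).

Lemma sum_fibers (g : I -> nat) P cs : uniq cs ->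
  (forall p, p \in P -> f p \in cs) ->
  (\sum_(p <- P) g (f p) = \sum_(c <- cs) count (fun p => f p == c) P * g c)%N.
Proof.
move=> ucs; elim: P => [|p P IH] hP /=.
  by rewrite big_nil big1 // => c _; rewrite mul0n.
rewrite big_cons IH; last by move=> q hq; apply: hP; rewrite inE hq orbT.
under [RHS]eq_bigr do rewrite mulnDl.
rewrite big_split /=; congr (_ + _)%N.
rewrite (bigD1_seq (f p)) ?hP ?mem_head //= eqxx mul1n big1 ?addn0 // => c.
by rewrite eq_sym => /negbTE ->.
Qed.

Lemma size_sum_fibers P cs : uniq cs -> (forall p, p \in P -> f p \in cs) ->
  size P = (\sum_(c <- cs) count (fun p => f p == c) P)%N.
Proof.
move=> ucs fcs; have := sum_fibers (fun=> 1%N) ucs fcs.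
by rewrite sum1_size => ->; apply: eq_bigr => c _; rewrite muln1.
Qed.

Lemma pigeonhole_fiber P cs : uniq cs -> (forall p, p \in P -> f p \in cs) ->
  (0 < size P)%N ->
  exists2 c, c \in cs & (size P <= size cs * count (fun p => f p == c) P)%N.
Proof.
move=> ucs hP P0; apply: contrapT => hno.
have := size_sum_fibers ucs hP.
have hlt c : c \in cs -> (size cs * count (fun p => f p == c) P < size P)%N.
  by move=> hc; rewrite ltnNge; apply/negP => h; apply: hno; exists c.
move=> e; case: cs ucs hP hno hlt e => [|c0 cs] ucs hP hno hlt e.
  by rewrite big_nil in e; rewrite e in P0.
have : (size (c0 :: cs) * size P < size (c0 :: cs) * size P)%N;
  last by rewrite ltnn.
rewrite {1}e big_distrr /= [X in (_ < X)%N]mulnC.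
set n := size (c0 :: cs).
have -> : (size P * n = \sum_(c <- c0 :: cs) size P)%N.
  by rewrite big_const_seq count_predT iter_addn_0.
rewrite !big_cons -addSn; apply: leq_add; first exact: (hlt c0 (mem_head _ _)).
rewrite big_seq [leqRHS]big_seq; apply: leq_sum => c hc.
by apply/ltnW/hlt; rewrite inE hc orbT.
Qed.

(** A fiber with more than [t] points has no light point, and every other fiber contributes at most
    [t]. *)
Lemma count_light_fibers P cs (t : nat) : uniq cs ->
  (forall p, p \in P -> f p \in cs) ->
  (count (fun p => count (fun q => f q == f p) P <= t)%N P <= size cs * t)%N.
Proof.
move=> ucs hP; set light := (X in count X).
rewrite -size_filter (@size_sum_fibers _ cs ucs); last first.
  by move=> p; rewrite mem_filter => /andP[_ /hP].
rewrite -sum1_size big_distrl /=; apply: leq_sum => c _; rewrite mul1n.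
rewrite count_filter; set k := (X in (X <= _)%N); case: (posnP k) => [->//|].
rewrite /k -has_count => /hasP[p pP /andP[/eqP fpc lp]].
apply: leq_trans lp; rewrite fpc; apply: sub_count => q /=.
by case/andP.
Qed.

(** Cauchy-Schwarz over the nonempty fibers: few coincidences of [f] force many values. *)
Lemma size_fibers_energy P :
  (size P ^ 2 <= size (undup (map f P)) *
     \sum_(p <- P) count (fun q => f q == f p) P)%N.
Proof.
set cs := undup _; set N := size cs.
have ucs : uniq cs by exact: undup_uniq.
have hcs p : p \in P -> f p \in cs by move=> pP; rewrite mem_undup map_f.
rewrite (sum_fibers (fun c => count (fun q => f q == c) P) ucs hcs) //.
set n := size P; pose k c := count (fun q => f q == c) P.
have en : \sum_(c <- cs) (k c)%:R = n%:R :> rat.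
  by rewrite -natr_sum /n (size_sum_fibers ucs hcs).
rewrite -(ler_nat rat) natrX natrM natr_sum.
under eq_bigr do rewrite natrM.
have [N0|N0] := posnP N.
  move: en; rewrite (size0nil N0) big_nil => <-; rewrite !big_nil expr0n mulr0;
    exact: lexx.
have NR : 0 < N%:R :> rat by rewrite ltr0n.
rewrite -(ler_pM2l NR) -subr_ge0.
(* The defect in Cauchy-Schwarz, multiplied by [N], is a sum of squares. *)
have -> : N%:R * (N%:R * \sum_(c <- cs) (k c)%:R * (k c)%:R) - N%:R * n%:R ^+ 2 =
  \sum_(c <- cs) (N%:R * (k c)%:R - n%:R) ^+ 2 :> rat.
  have -> : \sum_(c <- cs) (N%:R * (k c)%:R - n%:R) ^+ 2 =
    \sum_(c <- cs) (N%:R ^+ 2 * ((k c)%:R * (k c)%:R)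
      - 2 * N%:R * n%:R * (k c)%:R + n%:R ^+ 2) :> rat.
    by apply: eq_bigr => c _; ring.
  rewrite big_split /= sumrB -!mulr_sumr en big_const_seq count_predT -/N.
  rewrite iter_addr addr0 -(mulr_natl _ N); ring.
by apply: sumr_ge0 => c _; exact: sqr_ge0.
Qed.

End fibers.

(** * Dense configurations *)

Section dense_configurations.
Variable R : realType.
Implicit Types (p q x y : 'rV[R]_2) (P : seq 'rV[R]_2) (h s C L S : R).

(** A ball of the sup norm, so [L] is half the side. *)
Definition in_square x L p : bool :=
  (`|p 0 0 - x 0 0| <= L) && (`|p 0 1 - x 0 1| <= L).

Definition mass P x L : R := (count (in_square x L) P)%:R.

Definition grid_cell h p : int * int :=
  (Num.floor (p 0 0 / h), Num.floor (p 0 1 / h)).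

(** Separation is by cells, not by distance: two points may be close across a cell boundary. This
    form passes to sublists and still bounds the points of a square by the cells it meets. *)
Definition separated h P : bool := uniq [seq grid_cell h p | p <- P].

(** A violation, with constant [C] and between the scales [h] and [L], of the counting bound
    expected in Assouad dimension [s]. *)
Definition dense s h C P : Prop :=
  exists x L, h <= L /\ C * (L / h) `^ s < mass P x L.

Lemma separated_filter h (a : pred 'rV[R]_2) P :
  separated h P -> separated h [seq p <- P | a p].
Proof. by apply: subseq_uniq; apply: map_subseq; exact: filter_subseq. Qed.

Lemma mass_filter_le (a : pred 'rV[R]_2) P x L : mass [seq p <- P | a p] x L <=
  mass P x L.
Proof.
by rewrite ler_nat count_filter; apply: sub_count => p /andP[].
Qed.

Lemma mass_le_size P x L : mass P x L <= (size P)%:R.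
Proof. by rewrite ler_nat count_size. Qed.

Lemma mass_separated_le h P x L : 0 < h -> h <= L -> separated h P ->
  mass P x L <= 49 * (L / h) ^+ 2.
Proof.
move=> h0 hL sP; rewrite /mass -size_filter -(size_map (grid_cell h)).
have Lh1 : 1 <= L / h by rewrite ler_pdivlMr ?mul1r.
pose d := ((Num.truncn (L / h)).+1 + 1)%N.
(* The rounding costs an additive 5, absorbed by [1 <= L / h]; squaring 7 gives the constant 49. *)
have dle : (2 * d + 1)%:R <= 7 * (L / h).
  have := truncn_itv (ltW (lt_le_trans ltr01 Lh1)) => /andP[h1 _].
  rewrite /d; set t := Num.truncn _ in h1 *.
  have -> : (2 * (t.+1 + 1) + 1)%:R = 2 * t%:R + 5 :> R.
    by rewrite !natrD natrM !natrD -natr1; ring.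
  lra.
have near1 (u v : R) : `|u - v| <= L ->
  `|Num.floor (u / h) - Num.floor (v / h)| <= d%:Z.
  move=> uv; rewrite /d PoszD; apply: dist_floor_le.
  rewrite -mulrBl normrM (gtr0_norm (_ : 0 < h^-1)) ?invr_gt0 //.
  apply: le_trans (ltW (truncnS_gt (L / h))).
  by rewrite ler_pM2r ?invr_gt0.
have : (size [seq grid_cell h p | p <- [seq p <- P | in_square x L p]] <=
  (2 * d + 1) ^ 2)%N.
  apply: (@size_le_int_box (Num.floor (x 0 0 / h)) (Num.floor (x 0 1 / h))).
    exact: separated_filter.
  move=> c /mapP[p]; rewrite mem_filter => /andP[/andP[p0 p1] _] -> /=.
  by split; apply: near1.
rewrite -(ler_nat R) => /le_trans; apply.
rewrite natrX; apply: le_trans (_ : (7 * (L / h)) ^+ 2 <= _).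
  by rewrite ler_sqr ?nnegrE ?ler0n // mulr_ge0 //; apply: le_trans Lh1.
by rewrite exprMn; lra.
Qed.

Lemma powR_ge1 (u s : R) : 1 <= u -> 0 <= s -> 1 <= u `^ s.
Proof.
by move=> u1 s0; rewrite -(powRr0 u); apply: ler_powR.
Qed.

(* [S] is the supremum of the normalised masses [mass / (L / h) ^ s]; the square
   attains it up to a factor 2. *)
Lemma dense_frostman s h C P : 0 < h -> 0 <= s -> 0 < C -> separated h P ->
  dense s h C P ->
  exists x L S, [/\ h <= L, C <= S, S / 2 * (L / h) `^ s < mass P x L,
    forall x' L', h <= L' -> mass P x' L' <= S * (L' / h) `^ s &
    C <= 98 * (L / h) ^+ 2].
Proof.
move=> h0 s0 C0 sP [x [L [hL hd]]].
pose E := [set v : R | exists x L, h <= L /\ v = mass P x L / (L / h) `^ s].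
have pw L' : h <= L' -> 1 <= (L' / h) `^ s.
  by move=> hL'; apply: powR_ge1 => //; rewrite ler_pdivlMr ?mul1r.
have pw0 L' : h <= L' -> 0 < (L' / h) `^ s.
  by move=> /pw; apply: lt_le_trans.
have supE : has_sup E.
  split; first by exists (mass P x L / (L / h) `^ s), x, L.
  exists (size P)%:R => _ [x' [L' [hL' ->]]].
  rewrite ler_pdivrMr ?pw0 //; apply: le_trans (mass_le_size P x' L') _.
  by rewrite ler_peMr ?ler0n ?pw.
have ub v : E v -> v <= sup E by move: v; exact: sup_upper_bound.
have CS : C <= sup E.
  apply: le_trans (ub (mass P x L / (L / h) `^ s) _); last by exists x, L.
  by rewrite ler_pdivlMr ?pw0 // ltW.
have S0 : 0 < sup E / 2 by rewrite divr_gt0 // (lt_le_trans C0).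
have [_ [y [M [hM ->]]] yM] := sup_adherent S0 supE.
have {}yM : sup E / 2 * (M / h) `^ s < mass P y M.
  by rewrite -ltr_pdivlMr ?pw0 //; apply: le_lt_trans yM; lra.
exists y, M, (sup E); split => //.
  move=> x' L' hL'; rewrite -ler_pdivrMr ?pw0 //.
  by apply: ub; exists x', L'.
(* The square holds at most [49 * (M / h) ^ 2] points, so a large [C] forces a large ratio
   [M / h]. *)
have := mass_separated_le y h0 hM sP.
have : sup E / 2 <= sup E / 2 * (M / h) `^ s by rewrite ler_peMr ?pw // ltW.
by move: yM CS; set u := _ * _ `^ _; set v := _ ^+ 2; lra.
Qed.

End dense_configurations.

(** * Projections of Frostman sets *)

Section marstrand.
Variable R : realType.
Implicit Types (p q x y : 'rV[R]_2) (P : seq 'rV[R]_2) (h s t C L S : R).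

(** Up to the factor [sqrt (1 + t ^ 2)], between 1 and [sqrt 2] for slopes in [0, 1], this is the
    orthogonal projection to direction [(1, t)], discretised. *)
Definition strip t w p : int := Num.floor ((p 0 0 + t * p 0 1) / w).

(* [(a, b)] is the difference of two points.  Pairs at distance about
   [2 L / 2 ^ j] lie in a common strip of width [L / 2 ^ J] for at most about
   [2 ^ j] of the [2 ^ J] directions. *)
Lemma count_common_strips (J : nat) (L a b : R) : 0 < L ->
  `|a| <= 2 * L -> `|b| <= 2 * L ->
  exists2 j, (j <= J)%N &
    [/\ `|a| <= 2 * L / (2 ^ j)%:R, `|b| <= 2 * L / (2 ^ j)%:R &
     (count (fun k : nat => (`|a + k%:R / (2 ^ J)%:R * b| <= L / (2 ^ J)%:R)%R)
       (iota 0 (2 ^ J)) <= 9 * 2 ^ j)%N].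
Proof.
move=> L0 a2 b2; set N := count _ _.
have pow0 i : 0 < (2 ^ i)%:R :> R by rewrite ltr0n expn_gt0.
have powS i : (2 ^ i.+1)%:R = 2 * (2 ^ i)%:R :> R by rewrite expnS natrM.
apply: contrapT => hno.
(* Descent through dyadic levels: if the pair fits level [i] but not level [i + 1], then [j = i]
   satisfies the count. *)
have step i : (i <= J)%N ->
    `|a| <= 2 * L / (2 ^ i)%:R /\ `|b| <= 2 * L / (2 ^ i)%:R.
  elim: i => [_|i IH iJ]; first by rewrite expn0 divr1.
  have [ai bi] := IH (ltnW iJ).
  apply: contrapT => hi; apply: hno; exists i; first exact: ltnW.
  split=> //; set m := (2 ^ J)%:R : R.
  have mi : L / m <= L / 2 / (2 ^ i)%:R.
    rewrite -mulrA -invfM -powS ler_pM2l // lef_pV2 ?posrE ?pow0 //.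
    by rewrite ler_nat leq_pexp2l.
  set W := L / 2 / (2 ^ i)%:R in mi.
  have W2 : 2 * L / (2 ^ i.+1)%:R = 2 * W.
    by rewrite /W powS; field; rewrite gt_eqF.
  rewrite W2 in hi; have W0 : 0 < W by rewrite !divr_gt0.
  (* For small [b] the coordinate [a] dominates [t * b] for all slopes [t <= 1], and no direction
     qualifies. *)
  have [bW|bW] := leP `|b| W.
    rewrite /N (@eq_in_count _ _ pred0) ?count_pred0 // => k.
    rewrite mem_iota => /andP[_ kJ]; apply/negbTE; rewrite -ltNge.
    have aW : 2 * W < `|a|.
      rewrite ltNge; apply/negP => aW; apply: hi; split=> //.
      by apply: le_trans bW _; lra.
    have kb : `|k%:R / m * b| <= W.
      rewrite normrM; apply: le_trans bW; rewrite ler_piMl //.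
      by rewrite ger0_norm ?divr_ge0 // ler_pdivrMr ?pow0 // mul1r ler_nat ltnW.
    have := lerB_dist a (- (k%:R / m * b)); rewrite opprK normrN.
    by move: aW kb mi; lra.
  (* The admissible slopes now fill an interval of length [2 * L / (m * |b|)], so two admissible [k]
     differ by at most [2 ^ (i + 2)], and [2 * 2 ^ (i + 2) + 1 <= 9 * 2 ^ i]. *)
  have b0 : 0 < `|b| by apply: lt_trans bW.
  rewrite /N -size_filter; set ks := seq.filter _ _.
  have uks : uniq ks by rewrite filter_uniq // iota_uniq.
  case: (posnP (size ks)) => [->//|ks0].
  have [k0 k0ks] : exists k0, k0 \in ks.
    by case: (ks) ks0 => // k0 ? _; exists k0; rewrite mem_head.
  have dist k : k \in ks -> `|k%:Z - k0%:Z| <= (2 ^ i.+2)%:Z.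
    move: k0ks; rewrite !mem_filter => /andP[h0 _] /andP[h1 _].
    rewrite -(ler_int R) intr_norm rmorphB /=.
    rewrite -(ler_pM2r b0) -normrM.
    have -> : (k%:~R - k0%:~R) * b =
      m * ((a + k%:R / m * b) - (a + k0%:R / m * b)) :> R.
      by rewrite /=; field; rewrite gt_eqF ?pow0.
    rewrite normrM (gtr0_norm (pow0 J)).
    apply: le_trans (_ : m * (L / m + L / m) <= _).
      rewrite ler_pM2l ?pow0 //; apply: le_trans (ler_normB _ _) _.
      exact: lerD.
    have -> : m * (L / m + L / m) = 2 * L by field; rewrite gt_eqF ?pow0.
    have -> : 2 * L = (2 ^ i.+2)%:R * W.
      by rewrite /W !powS; field; rewrite gt_eqF.
    by rewrite ler_pM2l ?pow0 // ltW.
  have -> : size ks = size [seq k%:Z | k : nat <- ks] by rewrite size_map.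
  apply: leq_trans (@size_le_int_segment k0%:Z (2 ^ i.+2) _ _ _) _.
  - by rewrite map_inj_uniq // => u v [].
  - by move=> _ /mapP[k kks ->]; exact: dist.
  - have : (0 < 2 ^ i)%N by rewrite expn_gt0.
    by rewrite !expnS; move: (2 ^ i)%N; clear; lia.
(* The pair fits every level; at [j = J] the trivial count [2 ^ J] suffices. *)
apply: hno; exists J => //; have [aJ bJ] := step J (leqnn J).
split=> //; apply: leq_trans (count_size _ _) _; rewrite size_iota; lia.
Qed.

Lemma sum_geometric_le (r : R) (J : nat) : 0 <= r -> r < 1 ->
  \sum_(j <- iota 0 J) r ^+ j <= (1 - r)^-1.
Proof.
move=> r0 r1; have r1' : 0 < 1 - r by rewrite subr_gt0.
rewrite -[leRHS]mul1r ler_pdivlMr //.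
have -> : (\sum_(j <- iota 0 J) r ^+ j) * (1 - r) = 1 - r ^+ J.
  elim: J => [|J IH]; first by rewrite big_nil mul0r expr0 subrr.
  by rewrite -addn1 iotaD big_cat /= big_seq1 add0n mulrDl IH exprD expr1; ring.
by rewrite gerBl exprn_ge0.
Qed.

(** For [k < 2 ^ J] the square projects into length [4 * L], so the strips available number
    [O(2 ^ J)] and a fixed proportion of them is met. *)
Definition projection_good (J : nat) (k : nat) (c : R) P x L : Prop :=
  c * (2 ^ J)%:R <=
  (size (undup [seq strip (k%:R / (2 ^ J)%:R) (L / (2 ^ J)%:R) p
               | p <- P & in_square x L p]))%:R.

Lemma powR_exprn (u s : R) (j : nat) : 0 <= u -> (u ^+ j) `^ s = (u `^ s) ^+ j.
Proof.
move=> u0; elim: j => [|j IH]; first by rewrite !expr0 powR1.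
by rewrite !exprS powRM ?exprn_ge0 // IH.
Qed.

Lemma natr_count (T : Type) (a : pred T) (P : seq T) :
  (count a P)%:R = \sum_(q <- P) (a q)%:R :> R.
Proof.
by elim: P => [|p P IH]; rewrite ?big_nil // big_cons /= natrD IH.
Qed.

(** Each [q] is counted separately: it shares a strip with [p] in at most [9 * 2 ^ j] directions for
    some level [j] at which it lies in the square of half-side [2 * L / 2 ^ j] about [p], so the
    [j]-th mass term pays for it. *)
Lemma common_strips_energy (J : nat) P x L : 0 < L ->
  (forall p, p \in P -> in_square x L p) ->
  forall p, p \in P ->
  \sum_(q <- P) (count (fun k : nat =>
      strip (k%:R / (2 ^ J)%:R) (L / (2 ^ J)%:R) q ==
      strip (k%:R / (2 ^ J)%:R) (L / (2 ^ J)%:R) p) (iota 0 (2 ^ J)))%:R <=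
  9 * \sum_(j <- iota 0 J.+1) (2 ^ j)%:R * mass P p (2 * L / (2 ^ j)%:R).
Proof.
move=> L0 Px p pP; rewrite /mass mulr_sumr.
under [leRHS]eq_bigr do rewrite natr_count !mulr_sumr.
rewrite exchange_big /= big_seq [leRHS]big_seq; apply: ler_sum => q qP.
have m0 : 0 < (2 ^ J)%:R :> R by rewrite ltr0n expn_gt0.
have diff2 (u v w : R) : `|u - w| <= L -> `|v - w| <= L -> `|u - v| <= 2 * L.
  move=> uw vw; have := ler_normB (u - w) (v - w).
  have -> : u - w - (v - w) = u - v by ring.
  by lra.
have [/andP[p0 p1] /andP[q0 q1]] := (Px p pP, Px q qP).
have [j jJ [aj bj kj]] := count_common_strips J L0
  (diff2 _ _ _ q0 p0) (diff2 _ _ _ q1 p1).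
have jin : j \in iota 0 J.+1 by rewrite mem_iota ltnS jJ.
rewrite (bigD1_seq j jin (iota_uniq _ _)) /=.
rewrite [in_square p _ q]/in_square aj bj mulr1.
apply: le_trans (_ : 9 * (2 ^ j)%:R <= _); last first.
  by rewrite lerDl; apply: sumr_ge0 => i _; rewrite !mulr_ge0.
rewrite -natrM ler_nat; apply: leq_trans kj; apply: sub_count => k /eqP e.
have := floor_eq_dist e; set m := (2 ^ J)%:R in m0 *.
rewrite -mulrBl normrM (gtr0_norm (_ : 0 < (L / m)^-1)) ?invr_gt0 ?divr_gt0 //.
rewrite ltr_pdivrMr ?divr_gt0 // mul1r => /ltW.
by rewrite mulrBr opprD addrACA.
Qed.

(** Summed over all directions, the pairs in a common strip are controlled by a geometric series of
    ratio [2 ^ (1 - s)], bounded independently of [J] since [s > 1]. A direction with at most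
    average energy has many occupied strips by Cauchy-Schwarz. *)
Lemma frostman_projection s : 1 < s -> exists2 c : R, 0 < c &
  forall (J : nat) h P x L S, 0 < h -> h <= L / (2 ^ J)%:R ->
    S / 2 * (L / h) `^ s < mass P x L ->
    (forall x' L', h <= L' -> mass P x' L' <= S * (L' / h) `^ s) ->
    exists2 k, (k < 2 ^ J)%N & projection_good J k c P x L.
Proof.
move=> s1; pose r : R := 2^-1 `^ (s - 1).
have r0 : 0 <= r by exact: powR_ge0.
have half_s : 2^-1 `^ s = r / 2 :> R.
  rewrite -[s in LHS](subrK 1) powRD; last by apply/implyP => _; rewrite invr_eq0.
  by rewrite powRr1.
have r1 : r < 1.
  have e : 1 `^ (s - 1) = 1 :> R by rewrite powR1.
  rewrite -[ltRHS]e; apply: gt0_ltr_powR;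
    rewrite ?subr_gt0 ?nnegrE // invf_lt1 //; lra.
pose B : R := 9 * 2 `^ s / (1 - r).
have B0 : 0 < B by rewrite divr_gt0 ?mulr_gt0 ?powR_gt0 ?subr_gt0.
exists (2 * B)^-1; first by rewrite invr_gt0 mulr_gt0.
move=> J h P x L S h0 hJ massx frost.
set P1 := [seq p <- P | in_square x L p]; set n := size P1.
set m := (2 ^ J)%:R : R.
have m0 : 0 < m by rewrite ltr0n expn_gt0.
have L0 : 0 < L by have := lt_le_trans h0 hJ; rewrite pmulr_lgt0 // invr_gt0.
set lam := (L / h) `^ s in massx.
have lam0 : 0 < lam by rewrite powR_gt0 // divr_gt0.
have massn : mass P x L = n%:R by rewrite /mass /n size_filter.
pose E k := (\sum_(p <- P1) count (fun q => strip (k%:R / m) (L / m) q ==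
  strip (k%:R / m) (L / m) p) P1)%N.
have hL : h <= L.
  apply: le_trans hJ _; rewrite ler_pdivrMr // ler_peMr ?(ltW L0) //.
  by rewrite ler1n expn_gt0.
have S0 : 0 <= S.
  by have := le_trans (ler0n _ _) (frost x L hL); rewrite -/lam pmulr_lge0.
rewrite massn in massx.
have n0 : 0 < n%:R :> R.
  by apply: le_lt_trans massx; rewrite mulr_ge0 ?divr_ge0 // ltW.
have Ep p : p \in P1 -> 9 * \sum_(j <- iota 0 J.+1)
    (2 ^ j)%:R * mass P1 p (2 * L / (2 ^ j)%:R) <= B * (S * lam).
  move=> _; rewrite /B -!mulrA ler_pM2l //.
  apply: le_trans (_ : \sum_(j <- iota 0 J.+1) r ^+ j * (2 `^ s * (S * lam)) <= _).
    rewrite big_seq [leRHS]big_seq; apply: ler_sum => j.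
    rewrite mem_iota ltnS => jJ.
    have p0 : 0 < (2 ^ j)%:R :> R by rewrite ltr0n expn_gt0.
    (* The assumption [h <= L / 2 ^ J] keeps every square of the dyadic sum at a scale where the
       Frostman bound holds. *)
    have hj : h <= 2 * L / (2 ^ j)%:R.
      apply: le_trans hJ _; apply: ler_pM; rewrite ?invr_ge0 ?(ltW L0) //.
        by lra.
      by rewrite lef_pV2 ?posrE // ler_nat leq_pexp2l.
    apply: le_trans (_ : (2 ^ j)%:R * (S * (2 * L / (2 ^ j)%:R / h) `^ s) <= _).
      by rewrite ler_pM2l //;
        apply: le_trans (mass_filter_le _ _ _ _) (frost _ _ hj).
    have -> : 2 * L / (2 ^ j)%:R / h = (2^-1) ^+ j * (2 * (L / h)).
      by rewrite natrX exprVn; field; rewrite ?gt_eqF ?exprn_gt0.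
    have Lh0 : 0 <= L / h by rewrite divr_ge0 // ltW.
    rewrite (powRM _ (_ : 0 <=
      2^-1 ^+ j)) ?exprn_ge0 ?mulr_ge0 ?invr_ge0 ?(ltW L0) ?(ltW h0) //.
    rewrite (powRM _ (_ : 0 <= 2)) // -/lam powR_exprn // half_s expr_div_n natrX.
    by rewrite le_eqVlt; apply/orP; left; apply/eqP; field;
      rewrite ?gt_eqF ?exprn_gt0.
  rewrite -mulr_suml [leRHS]mulrCA ler_wpM2r ?mulr_ge0 ?powR_ge0 ?(ltW lam0) //.
  exact: sum_geometric_le.
have Esum : \sum_(k <- iota 0 (2 ^ J)) (E k)%:R <= n%:R * (B * (S * lam)).
  apply: le_trans (_ : \sum_(p <- P1) B * (S * lam) <= _); last first.
    by rewrite big_const_seq count_predT iter_addr_0 mulr_natl.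
  apply: le_trans (_ : \sum_(p <- P1) \sum_(q <- P1)
    (count (fun k : nat => strip (k%:R / m) (L / m) q == strip (k%:R / m) (L / m) p)
       (iota 0 (2 ^ J)))%:R <= _).
    under eq_bigr do rewrite natr_sum.
    rewrite exchange_big /=; apply: ler_sum => p _.
    under eq_bigr do rewrite natr_count.
    rewrite exchange_big /=; apply: ler_sum => q _.
    by rewrite natr_count.
  rewrite big_seq [leRHS]big_seq; apply: ler_sum => p pP.
  have P1x q : q \in P1 -> in_square x L q by rewrite mem_filter => /andP[].
  apply: le_trans (Ep p pP); exact: (common_strips_energy J L0 P1x pP).
have [k kJ Ek] : exists2 k, (k < 2 ^ J)%N & m * (E k)%:R <= n%:R * (B * (S * lam)).
  apply: contrapT => hno.
  have hk k : k \in iota 0 (2 ^ J) -> n%:R * (B * (S * lam)) < m * (E k)%:R.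
    rewrite mem_iota => kJ; rewrite ltNge; apply/negP => hk.
    by apply: hno; exists k.
  suff : m * (n%:R * (B * (S * lam))) < m * (n%:R * (B * (S * lam)))
    by rewrite ltxx.
  apply: (@lt_le_trans _ _ (m * \sum_(k <- iota 0 (2 ^ J)) (E k)%:R)); last first.
    by rewrite ler_pM2l.
  have -> : m * (n%:R * (B * (S * lam))) =
      \sum_(k <- iota 0 (2 ^ J)) n%:R * (B * (S * lam)).
    by rewrite big_const_seq count_predT iter_addr_0 size_iota /m mulr_natl.
  rewrite mulr_sumr big_seq [ltRHS]big_seq; apply: ltr_sum.
    by apply/hasP; exists 0%N; rewrite ?mem_iota ?expn_gt0.
  exact: hk.
exists k => //; rewrite /projection_good -/m -/P1.
have := size_fibers_energy (strip (k%:R / m) (L / m)) P1.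
rewrite -/(E k) -/n -(ler_nat R) natrX natrM; set N := size _ => CS.
have N0 : 0 <= N%:R :> R by exact: ler0n.
(* Combines [n ^ 2 <= N * E k], the average bound on [E k] and [S * lam < 2 * n]; cancelling [n ^ 2]
   leaves [m <= 2 * B * N]. *)
have : n%:R ^+ 2 * m <= n%:R ^+ 2 * (N%:R * (2 * B)).
  apply: le_trans (_ : N%:R * (m * (E k)%:R) <= _).
    by rewrite [leRHS]mulrCA [leRHS]mulrC ler_pM2r.
  apply: le_trans (ler_wpM2l N0 Ek) _.
  have -> : n%:R ^+ 2 * (N%:R * (2 * B)) = N%:R * (n%:R * (B * (2 * n%:R))) by ring.
  rewrite ler_wpM2l // ler_pM2l // ler_pM2l //; move: massx.
  by rewrite -mulrA mulrCA => massx; lra.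
rewrite ler_pM2l ?exprn_gt0 // => h1.
by rewrite ler_pdivrMl; [rewrite mulrC | rewrite mulr_gt0].
Qed.
End marstrand.

(** * Pins *)

Section parallel.
Variable R : realType.
Implicit Types (p q x y : 'rV[R]_2) (P : seq 'rV[R]_2) (h s t C L S w : R).

(** Constant on lines of direction [(1, t)]: the transverse coordinate of a tube. *)
Definition shear t p : R := p 0 1 - t * p 0 0.

Lemma exists_powR_gt (s B : R) : 0 < s ->
  exists2 n : nat, (0 < n)%N & B < n%:R `^ s.
Proof.
move=> s0; pose b := Num.max B 1; exists (Num.truncn (b `^ s^-1)).+1 => //.
have b1 : 0 <= b by rewrite le_max ler01 orbT.
have : B <= b by rewrite le_max lexx.
move=> /le_lt_trans; apply.
have sV : s^-1 * s = 1 by rewrite mulVf ?gt_eqF.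
rewrite -[ltLHS]powRr1 // -[X in _ `^ X < _]sV powRrM.
apply: gt0_ltr_powR => //; rewrite ?nnegrE ?powR_ge0 ?ler0n ?truncnS_gt //;
  exact: truncnS_gt.
Qed.

Lemma same_row_near t w p q (d : nat) : 0 <= t <= 1 -> 0 < w ->
  `|Num.floor (p 0 0 / w) - Num.floor (q 0 0 / w)| <= d%:Z ->
  Num.floor (shear t p / w) = Num.floor (shear t q / w) ->
  in_square q ((d + 2)%:R * w) p.
Proof.
move=> /andP[t0 t1] w0 hx hy.
have wV : 0 < w^-1 by rewrite invr_gt0.
have {}hx : `|p 0 0 - q 0 0| <= (d%:R + 1) * w.
  rewrite -ler_pdivrMr // -[w^-1]gtr0_norm // -normrM mulrBl.
  exact: floor_near.
have {}hy : `|shear t p - shear t q| <= w.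
  rewrite -[leRHS]mul1r -ler_pdivrMr // -[w^-1]gtr0_norm // -normrM mulrBl.
  exact/ltW/floor_eq_dist.
have -> : (d + 2)%:R * w = (d%:R + 1) * w + w by rewrite natrD; ring.
apply/andP; split; first by apply: le_trans hx _; lra.
have -> : p 0 1 - q 0 1 = t * (p 0 0 - q 0 0) + (shear t p - shear t q).
  by rewrite /shear; ring.
apply: le_trans (ler_normD _ _) (lerD _ hy); rewrite normrM (ger0_norm t0).
by apply: le_trans hx; rewrite ler_piMl.
Qed.

(* Most points of an almost maximal square [L] lie in [w]-cells (sheared along
   the direction [(1, t)], [w = L / M]) of large mass; some row of cells has at
   least its fair share of them.  By the Frostman bound with exponent [s > 1]
   they cannot all lie within [O(w)] of each other. *)
Lemma dense_parallel s (G : nat) : 1 < s -> s <= 2 ->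
  exists2 A, 0 < A & forall t h C P, 0 <= t <= 1 -> 0 < h -> 1 <= C ->
    separated h P -> dense s h (A * C) P ->
    exists (a : pred 'rV[R]_2) y w, [/\ y \in P, 0 < w,
      dense s h C [seq p <- P | a p] &
      forall p, a p ->
        `|shear t p - shear t y| <= w /\ G%:R * w <= p 0 0 - y 0 0].
Proof.
move=> s1 s2; have s0 : 0 < s by rewrite (lt_trans ltr01).
pose c := (G + 3)%:R : R.
have arithK (M : nat) : (0 < M -> 2 * (2 * M + 1) + 1 <= 7 * M)%N by lia.
have arithP2 (n' a l c' : nat) : (a * 2 <= n' -> l <= a -> l + c' = n' ->
  n' <= 2 * c')%N.
  by lia.
have s1' : 0 < s - 1 by rewrite subr_gt0.
(* With this [M], the Frostman bound makes a square of half-side [c * w] too light to hold one row's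
   share of the points. *)
have [M M0 Ms] := exists_powR_gt (28 * c `^ s) s1'.
have MR : 1 <= M%:R :> R by rewrite ler1n.
have MR0 : 0 < M%:R :> R by apply: lt_le_trans MR.
have MsE : M%:R `^ s = M%:R * M%:R `^ (s - 1).
  have e : s = 1 + (s - 1) by ring.
  rewrite {1}e [LHS]powRD; last by rewrite (gt_eqF MR0) implybT.
  by rewrite powRr1 // ltW.
have M20 : 0 < M%:R ^+ 2 :> R by rewrite exprn_gt0.
(* The price of passing to a single cell: [98 = 2 * 7 ^ 2] comes from the heaviness threshold, the
   remaining 8 from [2 ^ s <= 4] and the factor 2 in [massx]. *)
have [A AM] : exists A : R, 784 * M%:R ^+ 2 <= A by exists (784 * M%:R ^+ 2).
have A0 : 0 < A by lra.
exists A => //.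
move=> t h C P t01 h0 C1 sP dP.
have [t0 t1] := andP t01.
have C0 : 0 < C by apply: lt_le_trans C1.
have [x [L [S [hL CS massx frost Lh2]]]] :=
  dense_frostman h0 (ltW s0) (mulr_gt0 A0 C0) sP dP.
have L0 : 0 < L by apply: lt_le_trans hL.
have Lh : M%:R <= L / h.
  rewrite -ler_sqr ?nnegrE ?divr_ge0 ?(ltW L0) ?(ltW h0) ?(ltW MR0) //.
  have : A <= A * C by rewrite ler_peMr // ltW.
  by have : 0 <= (L / h) ^+ 2 by [exact: sqr_ge0]; move: Lh2 AM; lra.
pose w := L / M%:R; have w0 : 0 < w by rewrite divr_gt0.
have hw : h <= w by rewrite ler_pdivlMr // mulrC -ler_pdivlMr.
have wM : M%:R * w = L by rewrite /w mulrC divfK // gt_eqF.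
have S0 : 0 < S by apply: lt_le_trans CS; rewrite mulr_gt0.
set lam := (L / h) `^ s in massx.
have lam0 : 0 < lam by rewrite powR_gt0 // divr_gt0.
have powkw k : 0 <= k -> (k * w / h) `^ s = k `^ s * lam / M%:R `^ s.
  move=> k0; have -> : k * w / h = k * (L / h) * M%:R^-1.
    by rewrite /w; field; rewrite !gt_eqF.
  have Lh0 : 0 <= L / h by rewrite ltW // divr_gt0.
  rewrite powRM; last 2 first.
  - by rewrite mulr_ge0.
  - by rewrite invr_ge0 ltW.
  rewrite (powRM _ k0 Lh0) -/lam; congr (_ * _).
  have Ms0 : M%:R `^ s != 0 by rewrite gt_eqF ?powR_gt0.
  apply: (mulfI Ms0); rewrite mulfV // -powRM ?invr_ge0 ?(ltW MR0) //.
  by rewrite mulfV ?powR1 // gt_eqF.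
set P1 := [seq p <- P | in_square x L p]; set n := size P1.
have massn : mass P x L = n%:R by rewrite /mass /n size_filter.
rewrite massn in massx.
have n0 : (0 < n)%N.
  by rewrite -(ltr_nat R); apply: le_lt_trans massx;
    rewrite mulr_ge0 ?divr_ge0 // ltW.
pose fX p := Num.floor (p 0 0 / w); pose fY p := Num.floor (shear t p / w).
pose K := (2 * (2 * M + 1) + 1)%N.
have KM : (K <= 7 * M)%N by exact: arithK.
pose sX := int_segment (fX x) (2 * M + 1);
  pose sY := int_segment (fY x) (2 * M + 1).
have fXY p : p \in P1 -> fX p \in sX /\ fY p \in sY.
  rewrite mem_filter => /andP[/andP[p0 p1] _].
  have close (u v : R) : `|u - v| <= 2 * L ->
      `|Num.floor (u / w) - Num.floor (v / w)| <= (2 * M + 1)%:Z.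
    move=> uv; rewrite PoszD; apply: dist_floor_le.
    rewrite -mulrBl normrM (gtr0_norm (_ : 0 < w^-1)) ?invr_gt0 //.
    by rewrite ler_pdivrMr // natrM -mulrA wM.
  split; apply: mem_int_segment; apply: close; first by apply: le_trans p0 _; lra.
  have -> : shear t p - shear t x = (p 0 1 - x 0 1) - t * (p 0 0 - x 0 0).
    by rewrite /shear; ring.
  apply: le_trans (ler_normB _ _) _; rewrite normrM (ger0_norm t0).
  have : t * `|p 0 0 - x 0 0| <= L by apply: le_trans p0; rewrite ler_piMl.
  by lra.
pose f p := (fX p, fY p); pose cs := [seq (i, j) | i <- sX, j <- sY].
have ucs : uniq cs.
  by apply: allpairs_uniq; rewrite ?int_segment_uniq // => -[? ?] [? ?].
have szcs : size cs = (K * K)%N by rewrite size_allpairs !size_int_segment.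
have fcs p : p \in P1 -> f p \in cs.
  by move=> /fXY[pX pY]; apply/allpairsP; exists (fX p, fY p).
(* Half the average over the [K * K] cells, so at least half of the points lie in heavy cells. *)
pose T := (n %/ (2 * (K * K)))%N.
have TK : (K * K * T * 2 <= n)%N.
  by rewrite -mulnA mulnCA (mulnC (K * K)%N); exact: leq_divM.
have TK' : (n < 2 * (K * K) * T.+1)%N.
  by rewrite mulnC; apply: ltn_ceil; rewrite !muln_gt0 /K addn1.
pose light p := (count (fun q => f q == f p) P1 <= T)%N.
have := count_light_fibers T ucs fcs; rewrite -/light szcs => lightK.
set P2 := [seq p <- P1 | ~~ light p].
have P2n : (n <= 2 * size P2)%N.
  rewrite /P2 size_filter; apply: (arithP2 _ _ _ _ TK lightK); exact: count_predC.
have P20 : (0 < size P2)%N.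
  by rewrite -(@ltn_pmul2l 2) // muln0; apply: leq_trans P2n.
have P2Y p : p \in P2 -> fY p \in sY by rewrite mem_filter => /andP[_ /fXY[]].
have [j jY P3n] := pigeonhole_fiber (int_segment_uniq _ _) P2Y P20.
rewrite size_int_segment -/K -size_filter in P3n.
set P3 := seq.filter _ P2 in P3n.
have P3P p : p \in P3 -> [/\ fY p = j, ~~ light p & p \in P1].
  by rewrite !mem_filter => /andP[/eqP -> /andP[-> /andP[-> ->]]].
(* Otherwise the whole row fits in a square of half-side [c * w] about one of its points. Frostman
   then allows at most [S * (c * w / h) ^ s] points, less than the row's share [n / (14 * M)]. *)
have [p [q [pP3 qP3 pq]]] : exists p q, [/\ p \in P3, q \in P3 &
    fX q + G%:Z + 1 <= fX p].
  apply: contrapT => hno.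
  have [q qP3] : exists q, q \in P3.
    case: (P3) P3n => [|q P3' _]; last by exists q; rewrite mem_head.
    by rewrite muln0 leqNgt P20.
  have P3le : (size P3)%:R <= mass P q (c * w).
    have P3sub p : p \in P3 -> in_square q (c * w) p.
      move=> pP3; have [pj _ _] := P3P p pP3; have [qj _ _] := P3P q qP3.
      rewrite /c (_ : G + 3 = G.+1 + 2)%N; last by rewrite addnS.
      apply: (same_row_near (t := t)) => //; last by rewrite -/(fY p) -/(fY q) pj.
      have noPQ p' q' : p' \in P3 -> q' \in P3 -> fX p' - fX q' < G%:Z + 1.
        move=> hp hq; rewrite ltNge; apply/negP => hpq; apply: hno; exists p', q'.
        by split=> //; rewrite -addrA addrC -lerBrDr.
      have := noPQ _ _ pP3 qP3; have := noPQ _ _ qP3 pP3; rewrite /fX.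
      by clear; lia.
    rewrite /mass ler_nat -[leqLHS](_ : count (in_square q (c * w)) P3 = _);
      last first.
      by apply/eqP; rewrite -all_count; apply/allP.
    rewrite /P3 /P2 /P1 !count_filter; apply: sub_count => p' /=.
    by move=> /andP[/andP[/andP[->]]].
  have c0 : 0 < c by rewrite ltr0n addnS.
  have hcw : h <= c * w.
    by apply: le_trans hw _; rewrite ler_peMl ?(ltW w0) // ler1n addnS.
  have := le_trans P3le (frost q (c * w) hcw); rewrite (powkw _ (ltW c0)) => P3S.
  have nP3 : n%:R <= 14 * M%:R * (size P3)%:R :> R.
    rewrite -!natrM ler_nat; apply: leq_trans P2n _.
    apply: leq_trans (_ : 2 * (7 * M * size P3) <= _)%N; last by rewrite !mulnA.
    by rewrite leq_pmul2l //; apply: leq_trans P3n _; rewrite leq_mul2r KM orbT.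
  have Mlow0 : 0 < M%:R `^ (s - 1) by rewrite powR_gt0.
  have : S / 2 * lam < 14 * M%:R * (S * (c `^ s * lam / M%:R `^ s)).
    apply: lt_le_trans massx _; apply: le_trans nP3 _.
    by rewrite ler_pM2l // mulr_gt0.
  have -> : 14 * M%:R * (S * (c `^ s * lam / M%:R `^ s)) =
      S / 2 * lam * (28 * c `^ s / M%:R `^ (s - 1)).
    by rewrite MsE; field; rewrite !gt_eqF.
  rewrite ltr_pMr; last by rewrite mulr_gt0 ?divr_gt0.
  by rewrite ltr_pdivlMr // mul1r ltNge (ltW Ms).
have [pj plight pP1] := P3P p pP3; have [qj _ qP1] := P3P q qP3.
(* The pin is [q]; the refined set is the cell of [p], in the same row and at least [G * w] to the
   right. *)
exists (fun p' => in_square x L p' && (f p' == f p)), q, w; split => //.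
- by move: qP1; rewrite mem_filter => /andP[].
(* The square of half-side [2 * w] about [p] contains its cell, which is heavy and so has more than
   [T] points. *)
- exists p, (2 * w); split; first by apply: le_trans hw _; lra.
  rewrite (powkw 2) //.
  have -> : mass [seq p' <- P | in_square x L p' && (f p' == f p)] p (2 * w) =
      (count (fun p' => f p' == f p) P1)%:R.
    rewrite /mass /P1 !count_filter; congr (_%:R); apply: eq_count => p' /=.
    have [[eX eY]|] := eqVneq (f p') (f p); rewrite ?andbF ?andbT //=.
    rewrite andb_idl // => _; rewrite -[2]/((0 + 2)%:R).
    by apply: (same_row_near (t := t)) => //; rewrite -/(fX p') -/(fX p) eX subrr.
  apply: (@lt_le_trans _ _ T.+1%:R); last by rewrite ler_nat ltnNge.
  have nT : n%:R <= 98 * M%:R ^+ 2 * T.+1%:R :> R.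
    rewrite -natrX -!natrM ler_nat; apply: leq_trans (ltnW TK') _.
    rewrite leq_mul2r -[98%N]/(2 * (7 * 7))%N expnS expn1 -mulnA.
    by rewrite leq_pmul2l // [(7 * 7 * _)%N]mulnACA leq_mul ?orbT.
  have two4 : 2 `^ s <= 4 :> R.
    have -> : 4 = 2 `^ 2%:R :> R by rewrite powR_mulrn // expr2 -natrM.
    by apply: ler_powR => //; rewrite ler1n.
  have Mge1 : 1 <= M%:R `^ s by apply: powR_ge1 => //; exact: ltW.
  have lamS : lam * A * C < 2 * n%:R.
    have : A * C * lam <= S * lam by rewrite ler_pM2r.
    by move: massx; rewrite [lam * A * C]mulrC mulrA [S / 2 * lam]mulrAC; lra.
  have : C * (2 `^ s * lam / M%:R `^ s) <= 4 * (C * lam).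
    rewrite [leRHS]mulrCA ler_pM2l // ler_pdivrMr ?powR_gt0 //.
    apply: le_trans (_ : 4 * lam <= _); first by rewrite ler_pM2r.
    by rewrite ler_peMr // mulr_ge0 // ltW.
  move=> /le_lt_trans; apply.
  rewrite -(ltr_pM2l M20).
  have : 784 * M%:R ^+ 2 * (lam * C) <= A * (lam * C) by rewrite ler_pM2r ?mulr_gt0.
  by move: nT lamS; lra.
- move=> p' /andP[_ /eqP[eX eY]]; split.
  + rewrite -[leRHS]mul1r -ler_pdivrMr // -[w^-1]gtr0_norm ?invr_gt0 // -normrM mulrBl.
    by apply/ltW/floor_eq_dist; rewrite -/(fY p') -/(fY q) eY pj qj.
  + rewrite -ler_pdivlMr // mulrBl; apply: floor_gap.
    by rewrite -/(fX p') -/(fX q) eX.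
Qed.
End parallel.

(** * Euclidean distances to a pin *)

Section euclid.
Variable R : realType.
Implicit Types (p q x y : 'rV[R]_2).

Lemma edist1E (u v : 'rV[R]_1) : edist u v = `|u 0 0 - v 0 0|.
Proof. by rewrite /edist big_ord1 sqrtr_sqr. Qed.

Lemma edist2E p q :
  edist p q = Num.sqrt ((p 0 0 - q 0 0) ^+ 2 + (p 0 1 - q 0 1) ^+ 2).
Proof.
rewrite /edist big_ord_recl big_ord1.
by rewrite (_ : lift ord0 ord0 = 1) //; apply/val_inj.
Qed.

Lemma sqrt_sumsq_le (a b a' b' : R) :
  Num.sqrt (a ^+ 2 + b ^+ 2) <=
  Num.sqrt (a' ^+ 2 + b' ^+ 2) + (`|a - a'| + `|b - b'|).
Proof.
set N := Num.sqrt (a' ^+ 2 + _); set u := `|a - a'|; set v := `|b - b'|.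
have N0 : 0 <= N by exact: sqrtr_ge0.
have u0 : 0 <= u by exact: normr_ge0.
have v0 : 0 <= v by exact: normr_ge0.
have N2 : N ^+ 2 = a' ^+ 2 + b' ^+ 2 by rewrite sqr_sqrtr // addr_ge0 ?sqr_ge0.
have aN : `|a'| <= N by rewrite -sqrtr_sqr ler_wsqrtr // lerDl sqr_ge0.
have bN : `|b'| <= N by rewrite -sqrtr_sqr ler_wsqrtr // lerDr sqr_ge0.
have H (z z' : R) : `|z'| <= N ->
  z ^+ 2 <= z' ^+ 2 + 2 * N * `|z - z'| + `|z - z'| ^+ 2.
  move=> zN; rewrite real_normK ?num_real //.
  have : z' * (z - z') <= N * `|z - z'|.
    apply: le_trans (ler_norm _) _; rewrite normrM.
    by apply: ler_wpM2r.
  nra.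
have Ha := H a a' aN; have Hb := H b b' bN; rewrite -/u -/v in Ha Hb.
have T0 : 0 <= N + (u + v) by rewrite !addr_ge0.
rewrite -(ger0_norm T0) -sqrtr_sqr ler_wsqrtr //.
nra.
Qed.

Lemma edist_le_add p q : edist p q <= `|p 0 0 - q 0 0| + `|p 0 1 - q 0 1|.
Proof.
rewrite edist2E.
have := sqrt_sumsq_le (p 0 0 - q 0 0) (p 0 1 - q 0 1) 0 0.
by rewrite expr0n /= addr0 sqrtr0 add0r !subr0.
Qed.

Lemma edist_coord0 p q : `|p 0 0 - q 0 0| <= edist p q.
Proof. by rewrite edist2E -sqrtr_sqr ler_wsqrtr // lerDl sqr_ge0. Qed.

Lemma edist_coord1 p q : `|p 0 1 - q 0 1| <= edist p q.
Proof. by rewrite edist2E -sqrtr_sqr ler_wsqrtr // lerDr sqr_ge0. Qed.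

Lemma edist_dist_le y p q :
  `|edist y p - edist y q| <= `|p 0 0 - q 0 0| + `|p 0 1 - q 0 1|.
Proof.
have H (p' q' : 'rV[R]_2) : edist y p' <=
    edist y q' + (`|p' 0 0 - q' 0 0| + `|p' 0 1 - q' 0 1|).
  rewrite !edist2E; apply: le_trans (sqrt_sumsq_le _ _ (y 0 0 - q' 0 0) (y 0 1 - q' 0 1)) _.
  rewrite lerD2l; apply: lerD; rewrite -normrN le_eqVlt; apply/orP; left;
    apply/eqP; congr `|_|; ring.
have := H p q; have := H q p; rewrite ![`|q _ _ - _|]distrC ler_norml; lra.
Qed.

(* Far from the pin [y], in a thin cone around the direction [(1, t)], the
   distance to [y] is an almost affine function of [p 0 0 + t * p 0 1]. *)
Lemma pinned_distance_linear (G : nat) (t w r rho : R) y p q :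
  (0 < G)%N -> 0 <= t <= 1 -> 0 < w -> 0 < rho ->
  `|shear t p - shear t y| <= w -> G%:R * w <= p 0 0 - y 0 0 ->
  `|shear t q - shear t y| <= w -> G%:R * w <= q 0 0 - y 0 0 ->
  `|p 0 1 - q 0 1| <= 2 * rho ->
  `|edist y p - edist y q| <= r ->
  `|(p 0 0 + t * p 0 1) - (q 0 0 + t * q 0 1)| <= 3 * r + 2 * rho / G%:R.
Proof.
move=> G0 /andP[t0 t1] w0 rho0 pw pG qw qG pq dr.
have GR : 1 <= G%:R :> R by rewrite ler1n.
have GR0 : 0 < G%:R :> R by apply: lt_le_trans GR.
pose X := p 0 0 - y 0 0; pose X' := q 0 0 - y 0 0.
pose Y := shear t p - shear t y; pose Y' := shear t q - shear t y.
have wX : w <= X by apply: le_trans pG; rewrite ler_peMl // ltW.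
have wX' : w <= X' by apply: le_trans qG; rewrite ler_peMl // ltW.
have X0 : 0 < X by apply: lt_le_trans wX.
have X'0 : 0 < X' by apply: lt_le_trans wX'.
have e1 : p 0 1 - y 0 1 = Y + t * X by rewrite /Y /X /shear; ring.
have e1' : q 0 1 - y 0 1 = Y' + t * X' by rewrite /Y' /X' /shear; ring.
have Nle (z : 'rV[R]_2) (V W : R) : z 0 0 - y 0 0 = V ->
  z 0 1 - y 0 1 = W + t * V ->
    0 < V -> `|W| <= w -> w <= V -> edist y z <= 3 * V.
  move=> eV eW V0 Ww wV; apply: le_trans (edist_le_add _ _) _.
  rewrite [X in X + _]distrC [X in _ + X]distrC eV eW (gtr0_norm V0).
  have := ler_normD W (t * V); rewrite normrM (gtr0_norm V0) (ger0_norm t0).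
  have : t * V <= V by rewrite ler_piMl // ltW.
  lra.
have Np := Nle p X Y erefl e1 X0 pw wX; have Nq := Nle q X' Y' erefl e1' X'0 qw wX'.
have Np0 : 0 <= edist y p by exact: sqrtr_ge0.
have Nq0 : 0 <= edist y q by exact: sqrtr_ge0.
set N := edist y p in dr Np Np0; set N' := edist y q in dr Nq Nq0.
have N2 : N ^+ 2 = X ^+ 2 + (Y + t * X) ^+ 2.
  rewrite /N edist2E sqr_sqrtr ?addr_ge0 ?sqr_ge0 // -e1 /X; ring.
have N'2 : N' ^+ 2 = X' ^+ 2 + (Y' + t * X') ^+ 2.
  rewrite /N' edist2E sqr_sqrtr ?addr_ge0 ?sqr_ge0 // -e1' /X'; ring.
set Z := _ + _ - _.
have epq : p 0 1 - q 0 1 = (Y + t * X) - (Y' + t * X') by rewrite -e1 -e1'; ring.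
(* The difference of the squared distances is [(X + X') * Z] up to a transverse error. On division
   by [X + X'], the bound [N + N' <= 3 * (X + X')] yields [3 * r], and [2 * G * w <= X + X'] yields
   [2 * rho / G]. *)
have eZ : (X + X') * Z = (N - N') * (N + N') - (p 0 1 - q 0 1) * (Y + Y').
  have -> : Z = (X - X') + t * (p 0 1 - q 0 1) by rewrite /Z /X /X'; ring.
  have -> : (N - N') * (N + N') = N ^+ 2 - N' ^+ 2 by ring.
  by rewrite N2 N'2 epq; ring.
have XX0 : 0 < X + X' by rewrite addr_gt0.
have r0 : 0 <= r by apply: le_trans dr.
have b1 : `|(N - N') * (N + N')| <= r * (3 * (X + X')).
  rewrite normrM (ger0_norm (addr_ge0 Np0 Nq0)); apply: ler_pM => //;
    first exact: addr_ge0.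
  by lra.
have b2 : `|(p 0 1 - q 0 1) * (Y + Y')| <= 2 * rho * (2 * w).
  rewrite normrM; apply: ler_pM => //.
  by apply: le_trans (ler_normD _ _) _; rewrite /Y /Y'; lra.
have b3 : 2 * rho * (2 * w) <= 2 * rho / G%:R * (X + X').
  rewrite -[leRHS]mulrA ler_pM2l; last by rewrite mulr_gt0.
  rewrite [leRHS]mulrC ler_pdivlMr //; move: pG qG; rewrite -/X -/X'; lra.
rewrite -(ler_pM2l XX0) -[X in X * `|_|](gtr0_norm XX0) -normrM eZ.
apply: le_trans (ler_normB _ _) _; rewrite [leRHS]mulrDr.
by apply: lerD; [apply: le_trans b1 _|apply: le_trans b2 (le_trans b3 _)];
  rewrite le_eqVlt; apply/orP; left; apply/eqP; ring.
Qed.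

End euclid.

(** * Coverings and distance sets *)

Section coverings.
Variable R : realType.
Implicit Types (p q x y : 'rV[R]_2) (P : seq 'rV[R]_2) (F : set 'rV[R]_2).

Lemma covering_number_le (d : nat) (r : R) (E : set 'rV[R]_d) (c :
  seq 'rV[R]_d) (e : R) :
  0 < e -> (forall x p q : 'rV[R]_d, ball x e p -> ball x e q -> edist p q <= r) ->
  (forall p : 'rV[R]_d, E p -> exists2 x : 'rV[R]_d, x \in c & ball x e p) ->
  (covering_number r E <= (size c)%:R%:E)%E.
Proof.
move=> e0 er Ec; apply: ereal_inf_lbound; exists (size c) => //.
exists (fun i => ball (nth 0 c i) e); split.
  move=> i; split; first exact: ball_open.
  by apply: ub_ereal_sup => _ [[p q] [/= bp bq] <-]; rewrite lee_fin;
    exact: er bp bq.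
move=> p /Ec[x xc bp]; have ic : (index x c < size c)%N by rewrite index_mem.
by exists (Ordinal ic) => //=; rewrite nth_index.
Qed.

(** Take a separated subset of maximal size: a point outside all sup-norm balls of radius [r / 4]
    about it would occupy a new cell. Such a ball spreads less than [r / 2] in each of the two
    coordinates, hence has diameter at most [r]. *)
Lemma covering_number_separated F x (rho r : R) : 0 < r -> r < rho ->
  exists P, [/\ separated (r / 4) P, forall p, p \in P -> F p,
    mass P x rho = (size P)%:R &
    (covering_number r (eclosed_ball x rho `&` F) <= (size P)%:R%:E)%E].
Proof.
move=> r0 rrho; set h := r / 4; have h0 : 0 < h by rewrite divr_gt0.
pose E := eclosed_ball x rho `&` F.
pose Q n := `[< exists P, [/\ separated h P, forall p, p \in P ->
  E p & size P = n] >].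
have Esq p : E p -> in_square x rho p.
  move=> [xp _]; apply/andP; split; rewrite distrC.
    exact: le_trans (edist_coord0 _ _) xp.
  exact: le_trans (edist_coord1 _ _) xp.
have massE P : (forall p, p \in P -> E p) -> mass P x rho = (size P)%:R.
  by move=> PE; congr (_%:R); apply/eqP; rewrite -all_count;
    apply/allP => p /PE/Esq.
have Q0 : exists n, Q n by exists 0%N; apply/asboolP; exists [::].
have Qub n : Q n -> (n <= Num.truncn (49 * (rho / h) ^+ 2))%N.
  move=> /asboolP[P [sP PE <-]].
  rewrite truncn_ge_nat; last by rewrite mulr_ge0 ?sqr_ge0.
  rewrite -(massE P PE).
  apply: mass_separated_le => //; rewrite /h; lra.
case: (ex_maxnP Q0 Qub) => n /asboolP[P [sP PE szP]] nmax.
exists P; split => //; first by move=> p /PE[].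
  exact: massE.
apply: (@covering_number_le _ _ _ _ h) => //.
  move=> z p q [_ zp] [_ zq]; apply: le_trans (edist_le_add _ _) _.
  have close (i : 'I_1) j : `|p i j - q i j| <= r / 2.
    have := zp i j; have := zq i j; rewrite /ball /= => qz pz.
    apply: le_trans (ler_distD (z i j) _ _) _; rewrite distrC.
    by move: qz pz; rewrite /h; lra.
  by have := close 0 0; have := close 0 1; lra.
move=> p Ep; apply: contrapT => hno.
have : (n.+1 <= n)%N; last by rewrite ltnn.
apply: nmax; apply/asboolP; exists (p :: P); split => //=; last by rewrite szP.
  rewrite /separated /= -/(separated h P) sP andbT;
    apply/negP => /mapP[q qP [e0 e1]].
  apply: hno; exists q => //.
  have hV : 0 < h^-1 by rewrite invr_gt0.
  have near1 (u v : R) : Num.floor (u / h) = Num.floor (v / h) -> ball v h u.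
    move=> /floor_eq_dist; rewrite -mulrBl normrM (gtr0_norm hV) ltr_pdivrMr //.
    by rewrite mul1r /ball /= distrC.
  split=> // i j; rewrite ord1; apply: near1.
  case: j => -[|[|//]] jlt.
    by rewrite (_ : Ordinal jlt = 0) //; apply/val_inj.
  by rewrite (_ : Ordinal jlt = 1) //; apply/val_inj.
by move=> q; rewrite inE => /predU1P[->|/PE].
Qed.

(** Otherwise the separated subsets of [F] are all small, their sizes bound the covering numbers,
    and [s] is admissible in the infimum. The factor [4 ^ s] accounts for the scale [r / 4]. *)
Lemma not_assouad_dense F (s : R) : 0 <= s -> (s%:E < assouad_dim F)%E ->
  forall C : R, exists h P, [/\ 0 < h, forall p, p \in P -> F p,
    separated h P & dense s h C P].
Proof.
move=> s0 sF C; apply: contrapT => hno.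
have : (assouad_dim F <= s%:E)%E; last by rewrite leNgt sF.
apply: ereal_inf_lbound; exists s => //=; split=> //.
pose C' := Num.max C 1; have C'0 : 0 < C' by rewrite lt_max ltr01 orbT.
exists (C' * 4 `^ s); split; first by rewrite mulr_gt0 ?powR_gt0.
move=> rho rho0 r r0 rrho x Fx.
have [P [sP PF massP cov]] := covering_number_separated F x r0 rrho.
apply: le_trans cov _; rewrite lee_fin leNgt; apply/negP => hP.
apply: hno; exists (r / 4), P; split => //; first by rewrite divr_gt0.
exists x, rho; split; first lra.
rewrite massP; apply: le_lt_trans hP.
have -> : rho / (r / 4) = 4 * (rho / r) by field; rewrite gt_eqF.
have q0 : 0 <= rho / r by rewrite divr_ge0 // ltW.
rewrite powRM // mulrA ler_wpM2r ?powR_ge0 // ler_wpM2r ?powR_ge0 //.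
by rewrite le_max lexx.
Qed.

(** Distances in one covering set differ by at most [rho / m], so by [pinned_distance_linear] with
    [G = 2 ^ J] the projections differ by at most [5 * rho / m]. Strip indices then differ by at
    most 6, leaving 13 strips per covering set. *)
Lemma distance_set_covering F x y P (J k : nat) (w rho B : R) (p0 : 'rV[R]_2) :
  let m := (2 ^ J)%:R : R in
  let Q := [seq p <- P | in_square x rho p] in
  (k < 2 ^ J)%N -> 0 < w -> 0 < rho -> F y -> (forall p, p \in P -> F p) ->
  (forall p, p \in P -> `|shear (k%:R / m) p - shear (k%:R / m) y| <= w /\
     m * w <= p 0 0 - y 0 0) ->
  p0 \in Q ->
  (covering_number (rho / m) (eclosed_ball (const_mx (edist y p0)) (4 * rho)
     `&` real_line (distance_set F)) <= B%:E)%E ->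
  (size (undup [seq strip (k%:R / m) (rho / m) p | p <- Q]))%:R <= 13 * B.
Proof.
move=> m Q kJ w0 rho0 Fy PF Py p0Q covB.
have m0 : 0 < m by rewrite ltr0n expn_gt0.
have t01 : 0 <= k%:R / m <= 1.
  by rewrite divr_ge0 //= ler_pdivrMr // mul1r ler_nat ltnW.
set cs := undup _; set E := _ `&` real_line _ in covB.
suff H : (((size cs)%:R / 13)%:E <= covering_number (rho / m) E)%E.
  by have := le_trans H covB; rewrite lee_fin ler_pdivrMr // mulrC.
apply: le_ereal_inf_tmp => _ [N [U [Usize EU]] <-].
rewrite lee_fin ler_pdivrMr //.
have QP p : p \in Q -> in_square x rho p /\ p \in P.
  by rewrite mem_filter => /andP.
have Qclose p q : p \in Q -> q \in Q ->
    `|p 0 0 - q 0 0| <= 2 * rho /\ `|p 0 1 - q 0 1| <= 2 * rho.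
  move=> /QP[/andP[p1 p2] _] /QP[/andP[q1 q2] _].
  split.
    by apply: le_trans (ler_distD (x 0 0) _ _) _; rewrite [X in _ + X]distrC; lra.
  by apply: le_trans (ler_distD (x 0 1) _ _) _; rewrite [X in _ + X]distrC; lra.
pose pt p : 'rV[R]_1 := const_mx (edist y p).
(* Two points of [Q] differ by at most [2 * rho] in each coordinate, whence the radius [4 * rho]. *)
have Ept p : p \in Q -> E (pt p).
  move=> pQ; split.
    rewrite /eclosed_ball /= edist1E !mxE; apply: le_trans (edist_dist_le _ _ _) _.
    by have [] := Qclose _ _ p0Q pQ; lra.
  by exists (edist y p) => //; exists y, p; split=> //; apply: PF;
    have [] := QP p pQ.
(* The index is a natural number so that 0 can serve as default outside [cs], even when [N = 0]. *)
have covered (c : int) : exists i : nat, c \in cs -> exists p (i' : 'I_N),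
    [/\ p \in Q, strip (k%:R / m) (rho / m) p = c, i' = i :> nat & U i' (pt p)].
  have [ccs|ccs] := boolP (c \in cs); last by exists 0%N.
  move: ccs; rewrite mem_undup => /mapP[p pQ ->].
  have [i _ Ui] := EU _ (Ept p pQ).
  by exists i => _; exists p, i.
have [g gP] := choice covered.
have [cs0|cs0] := posnP (size cs); first by rewrite cs0 mulr_ge0.
have gcs c : c \in cs -> g c \in iota 0 N.
  by move=> /gP[p [i [_ _ <- _]]]; rewrite mem_iota /=.
have [i iN] := pigeonhole_fiber (iota_uniq _ _) gcs cs0.
rewrite size_iota => szN.
have szi : (count (fun c => g c == i) cs <= 13)%N.
  rewrite -size_filter; set ci := seq.filter _ _.
  case: (posnP (size ci)) => [->//|ci0].
  have [c0 c0i] : exists c0, c0 \in ci.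
    by case: (ci) ci0 => // c0 ? _; exists c0; rewrite mem_head.
  apply: (@size_le_int_segment c0 6); first by rewrite filter_uniq ?undup_uniq.
  move=> c; rewrite mem_filter => /andP[/eqP gc /gP[p [i1 [pQ ec i1E Up]]]].
  move: c0i; rewrite mem_filter => /andP[/eqP gc0 /gP[q [i2 [qQ ec0 i2E Uq]]]].
  have i12 : i1 = i2 by apply/val_inj; rewrite /= i1E i2E gc gc0.
  rewrite -i12 in Uq.
  have dpq : `|edist y p - edist y q| <= rho / m.
    have -> : `|edist y p - edist y q| = edist (pt p) (pt q)
      by rewrite edist1E !mxE.
    rewrite -lee_fin; apply: le_trans (Usize i1).2.
    by apply: ereal_sup_ubound; exists (pt p, pt q).
  have [_ pP] := QP p pQ; have [_ qP] := QP q qQ.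
  have [p1 p2] := Py p pP; have [q1 q2] := Py q qP.
  have [_ pq1] := Qclose p q pQ qQ.
  have J0 : (0 < 2 ^ J)%N by rewrite expn_gt0.
  have := pinned_distance_linear J0 t01 w0 rho0 p1 p2 q1 q2 pq1 dpq.
  rewrite -/m -ec -ec0 => lin; have -> : 6%:Z = 5%:Z + 1 by [].
  apply: dist_floor_le; have rm0 : 0 < rho / m by rewrite divr_gt0.
  rewrite -mulrBl normrM (gtr0_norm (_ : 0 < (rho / m)^-1)) ?invr_gt0 //.
  rewrite ler_pdivrMr //; apply: le_trans lin _.
  by rewrite -[2 * rho / m]mulrA; lra.
rewrite -natrM ler_nat; apply: leq_trans szN _.
by rewrite leq_mul2l szi orbT.
Qed.

Lemma projection_good_filter (J k : nat) (c : R) P x (L : R) (a : pred 'rV[R]_2) :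
  projection_good J k c [seq p <- P | a p] x L -> projection_good J k c P x L.
Proof.
move=> /le_trans; apply; rewrite ler_nat; apply: uniq_leq_size;
  first exact: undup_uniq.
move=> i; rewrite !mem_undup => /mapP[p]; rewrite !mem_filter => /and3P[px _ pP] ->.
by apply: map_f; rewrite mem_filter px.
Qed.

Lemma assouad_line_le1 (A : set 'rV[R]_1) : (assouad_dim A <= 1)%E.
Proof.
apply: ereal_inf_lbound; exists 1 => //=; split=> //; exists 5; split=> //.
move=> rho rho0 r r0 rrho x Ax.
have q1 : 1 < rho / r by rewrite ltr_pdivlMr // mul1r.
rewrite powRr1; last by rewrite ltW // (lt_trans ltr01).
(* Centres at spacing [r / 2] along an interval of length [2 * rho]: at most [4 * (rho / r) + 1],
   below [5 * (rho / r)]. *)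
pose N := (Num.truncn (4 * (rho / r))).+1.
pose c := [seq const_mx (x 0 0 - rho + i%:R * (r / 2)) : 'rV[R]_1 | i <- iota 0 N].
apply: le_trans (_ : ((size c)%:R%:E <= _)%E); last first.
  rewrite lee_fin size_map size_iota /N -natr1.
  have T0 : 0 <= 4 * (rho / r) by lra.
  by have /andP[h1 _] := truncn_itv T0; lra.
have r20 : 0 < r / 2 by rewrite divr_gt0.
apply: (@covering_number_le _ _ _ _ (r / 2)) => //.
  move=> z p q [_ /(_ 0 0) zp] [_ /(_ 0 0) zq]; rewrite /ball /= in zp zq.
  rewrite edist1E; apply: le_trans (ler_distD (z 0 0) _ _) _; rewrite distrC.
  by move: zp zq; lra.
move=> p [xp _]; move: xp;
  rewrite /eclosed_ball /= edist1E ler_norml => /andP[h1 h2].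
set u := (p 0 0 - (x 0 0 - rho)) / (r / 2).
have u0 : 0 <= u by rewrite divr_ge0 //; lra.
have /andP[ui iu] := truncn_itv u0; set i := Num.truncn u in ui iu.
have ur : p 0 0 = x 0 0 - rho + u * (r / 2) by rewrite /u divfK ?gt_eqF //; ring.
exists (const_mx (x 0 0 - rho + i%:R * (r / 2))).
  apply/mapP; exists i => //; rewrite mem_iota add0n ltnS; apply: le_truncn.
  rewrite /u ler_pdivrMr // (_ : 4 * (rho / r) * (r / 2) = 2 * rho); first by lra.
  by field; rewrite gt_eqF.
split=> // a b; rewrite !ord1 /ball /= mxE ur opprD addrACA subrr add0r -mulrBl.
rewrite normrM (gtr0_norm r20) -[ltRHS]mul1r ltr_pM2r // distrC ger0_norm;
  last by lra.
by rewrite ltrBlDl natr1.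
Qed.

End coverings.

(** * Excluding the directions one after another *)

Section avoidance.
Variable R : realType.
Implicit Types (P : seq 'rV[R]_2) (F : set 'rV[R]_2).

(** Given a set excluding the directions below [j], [dense_parallel] in direction [j] finds a pin
    for a dense subset, and [nopair] then excludes [j]; earlier exclusions pass to subsets.
    Quantifying over all [C] pays for the factor [A] lost at each stage. *)
Lemma dense_bad_directions F (s c : R) (J : nat) : 1 < s -> s <= 2 ->
  0 < c ->
  (forall C : R, exists h P, [/\ 0 < h, forall p, p \in P -> F p,
     separated h P & dense s h C P]) ->
  (forall (k : nat) (w rho : R) (x y : 'rV[R]_2) P, (k < 2 ^ J)%N -> 0 < w ->
     0 < rho -> F y -> (forall p, p \in P -> F p) ->
     (forall p, p \in P ->
        `|shear (k%:R / (2 ^ J)%:R) p - shear (k%:R / (2 ^ J)%:R) y| <= w /\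
        (2 ^ J)%:R * w <= p 0 0 - y 0 0) ->
     ~ projection_good J k c P x rho) ->
  forall j, (j <= 2 ^ J)%N -> forall C : R, 1 <= C ->
  exists h P, [/\ 0 < h, forall p, p \in P -> F p, separated h P, dense s h C P &
    forall k x rho, (k < j)%N -> 0 < rho -> ~ projection_good J k c P x rho].
Proof.
move=> s1 s2 c0 Fdense nopair; elim=> [_|j IH jJ] C C1.
  by have [h [P [h0 PF sP dP]]] := Fdense C; exists h, P; split.
have [A A0 HA] := dense_parallel (2 ^ J) s1 s2.
have AC1 : 1 <= Num.max (A * C) 1 by rewrite le_max lexx orbT.
have [h [P [h0 PF sP dP bad]]] := IH (ltnW jJ) _ AC1.
pose u : R := j%:R / (2 ^ J)%:R.
have t01 : 0 <= u <= 1.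
  by rewrite divr_ge0 //= ler_pdivrMr ?ltr0n ?expn_gt0 // mul1r ler_nat ltnW.
have dP' : dense s h (A * C) P.
  have [x [L [hL hd]]] := dP; exists x, L; split=> //; apply: le_lt_trans hd.
  by rewrite ler_wpM2r ?powR_ge0 // le_max lexx.
have [a [y [w [yP w0 daP ay]]]] := HA _ _ _ _ t01 h0 C1 sP dP'.
exists h, [seq p <- P | a p]; split => //.
- by move=> p; rewrite mem_filter => /andP[_ /PF].
- exact: separated_filter.
move=> k x rho; rewrite ltnS leq_eqVlt => /predU1P[->|kj] rho0 good; last first.
  exact: (bad k x rho kj rho0 (projection_good_filter good)).
apply: (nopair j w rho x y _ jJ w0 rho0 (PF y yP) _ _ good).
  by move=> p; rewrite mem_filter => /andP[_ /PF].
by move=> p; rewrite mem_filter => /andP[/ay].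
Qed.

End avoidance.

(** * The dimension of the distance set *)

Unset Implicit Arguments.

Theorem theorem2p3 (R : realType) (F : set 'rV[R]_2)
    (hF : (1 < assouad_dim F)%E) :
  assouad_dim (real_line (distance_set F)) = 1%E.
Proof.
apply/eqP; rewrite eq_le assouad_line_le1 /=.
have [s [s1 s2 sF]] : exists s : R, [/\ 1 < s, s <= 2 & (s%:E < assouad_dim F)%E].
  case: (assouad_dim F) hF => [r| |] //= r1; last by exists 2; split;
    rewrite ?ltry //; lra.
  move: r1; rewrite lte_fin => r1; have [r3|r3] := leP r 3.
    by exists ((1 + r) / 2); split; rewrite ?lte_fin; lra.
  by exists 2; split; rewrite ?lte_fin; lra.
have s0 : 0 < s by rewrite (lt_trans ltr01).
have Fdense := not_assouad_dense (ltW s0) sF.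
have [c c0 Hc] := frostman_projection s1.
apply: le_ereal_inf_tmp => _ [t [t0 [C [C0 HC]]] <-].
rewrite lee_fin leNgt; apply/negP => t1.
have t1' : 0 < 1 - t by rewrite subr_gt0.
(* Since [t < 1], a linear term [c * m] beats [13 * C * (4 * m) ^ t] for large [m]; [J < 2 ^ J] lets
   [m] be a power of 2. *)
have [J J0 HJ] := exists_powR_gt (13 * C * 4 `^ t / c) t1'.
set m := (2 ^ J)%:R : R.
have m1 : 1 <= m by rewrite ler1n expn_gt0.
have m0 : 0 < m by apply: lt_le_trans m1.
have mbig : 13 * (C * (4 * m) `^ t) < c * m.
  have Jm : J%:R `^ (1 - t) <= m `^ (1 - t).
    apply: ge0_ler_powR; rewrite ?nnegrE ?ler0n //; first exact: ltW.
    by rewrite /m ler_nat ltnW // ltn_expl.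
  have mE : m = m `^ (1 - t) * m `^ t.
    by rewrite -powRD ?subrK ?powRr1 ?ltW // gt_eqF ?implybT.
  have := lt_le_trans HJ Jm; rewrite ltr_pdivrMr // => h1.
  rewrite [X in _ < c * X]mE powRM ?ltW // mulrA [X in _ < X]mulrA.
  rewrite mulrA ltr_pM2r ?powR_gt0 //; move: h1; rewrite mulrC; lra.
(* A pin and a good projection would give at least [c * m] strips, while the covering bound for the
   distance set between the scales [rho / m] and [4 * rho] allows only [13 * C * (4 * m) ^ t]. *)
have nopair (k : nat) (w rho : R) (x y : 'rV[R]_2) P : (k < 2 ^ J)%N -> 0 < w ->
     0 < rho -> F y -> (forall p, p \in P -> F p) ->
     (forall p, p \in P ->
        `|shear (k%:R / (2 ^ J)%:R) p - shear (k%:R / (2 ^ J)%:R) y| <= w /\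
        (2 ^ J)%:R * w <= p 0 0 - y 0 0) ->
     ~ projection_good J k c P x rho.
  move=> kJ w0 rho0 Fy PF Py good.
  have : c * m <= 13 * (C * (4 * m) `^ t); last by rewrite leNgt mbig.
  apply: le_trans good _.
  (* The covering bound needs a ball centred in the distance set: a point [p0] of the square
     supplies the centre [edist y p0]. *)
  have [Q0|[p0 p0Q]] : [seq p <- P | in_square x rho p] = [::] \/
      exists p0, p0 \in [seq p <- P | in_square x rho p].
    by case: [seq _ <- _ | _] => [|p0 ?]; [left|right; exists p0; rewrite mem_head].
    by rewrite Q0 /= mulr_ge0 // mulr_ge0 ?powR_ge0 // ltW.
  apply: (distance_set_covering kJ w0 rho0 Fy PF Py p0Q).
  rewrite -/m; have -> : 4 * m = 4 * rho / (rho / m).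
    by field; rewrite !gt_eqF.
  have rm : rho / m < 4 * rho.
    by rewrite ltr_pdivrMr // [ltRHS]mulrC mulrA ltr_pMl //; lra.
  have rho4 : 0 < 4 * rho by rewrite mulr_gt0.
  apply: (HC _ rho4 _ (divr_gt0 rho0 m0) rm).
  exists (edist y p0) => //; exists y, p0; split=> //; apply: PF.
  by move: p0Q; rewrite mem_filter => /andP[].
(* With this density constant, [dense_frostman] gives [m <= L / h], the room between scales that
   [frostman_projection] requires. *)
have C1 : 1 <= 98 * m ^+ 2 by have : 1 <= m ^+ 2 by [exact: exprn_ege1]; lra.
have [h [P [h0 PF sP dP bad]]] :=
  dense_bad_directions s1 s2 c0 Fdense nopair (leqnn _) C1.
have [x [L [S [hL CS massx frost Lh]]]] :=
  dense_frostman h0 (ltW s0) (lt_le_trans ltr01 C1) sP dP.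
have L0 : 0 < L by apply: lt_le_trans hL.
have hm : h <= L / m.
  have : m <= L / h.
    rewrite -ler_sqr ?nnegrE ?divr_ge0 ?(ltW L0) ?(ltW h0) ?(ltW m0) //.
    by move: Lh; lra.
  by rewrite !ler_pdivlMr // mulrC.
have [k kJ good] := Hc J h P x L S h0 hm massx frost.
exact: (bad k x L kJ L0 good).
Qed.
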